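(* Let $A\in\mathbb{R}^{n\times d}$, $u^\star\in\mathbb{R}^d$, $\varepsilon\in\mathbb{R}^n$, $y=Au^\star+\varepsilon$, and suppose $\mathrm{supp}(u^\star)\subset S\subset\{1,\dots,d\}$ with $|S|=s$. Let $\lambda>0$, $0<\eta<1/2$, and let $(\hat u,\hat\theta)$ be the unique minimizer over $(u,\theta)\in\mathbb{R}^d\times(0,\infty)^d$ of $$\mathsf{J}(u,\theta)=\frac1{2n}\|y-Au\|_2^2+\frac{\lambda}{2\sqrt2}\sum_{j=1}^d\frac{u_j^2}{\theta_j}+\frac{\lambda}{\sqrt2}\sum_{j=1}^d(\theta_j-\eta\log\theta_j).$$ Assume that $\lambda\ge\frac{2\|A^T\varepsilon\|_\infty}{n}$ and that $A$ satisfies the restricted strong convexity condition with curvature $\kappa>0$ and tolerance $\tau^2$ ($\tau\ge0$) with respect to the $\ell_1$ norm, i.e. $\frac{\|A\Delta\|_2^2}{2n}\ge\frac\kappa2\|\Delta\|_2^2-\tau^2\|\Delta\|_1^2$ for all $\Delta\in\mathbb{R}^d$. If $\tau\sqrt s\le\frac{\sqrt\kappa}{32}$, then $$\|\hat u-u^\star\|_2^2\lesssim s\frac{\lambda^2}{\kappa^2}+\mathcal{E}_\eta,$$ where $$\mathcal{E}_\eta:=\frac{\tau^2}{\kappa}\Bigl(\eta^2\|u^\star_S\|_1^2+\frac{d^2\eta^2}{2}(2-\log\eta)^2\Bigr)+\frac\lambda\kappa\Bigl(\eta\|u^\star_S\|_1+\frac{d\eta}{\sqrt2}(2-\log\eta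)\Bigr).$$
   Context: $a\lesssim b$ means $a\le Cb$ for an absolute constant $C>0$. $\mathrm{supp}(u)$ is the set of indices of nonzero entries, and $u_S$ is the vector $u$ restricted to the indices in $S$. The functional $\mathsf{J}$ is the negative log-posterior (up to scaling and additive constants) of a hierarchical Gaussian model with gamma hyperpriors; it is strictly convex and has a unique minimizer. *)

(* Defs.v *)
From HB Require Import structures.
From mathcomp Require Import all_boot all_order all_algebra.
From mathcomp Require Import all_classical all_reals all_analysis.

Set Implicit Arguments.
Unset Strict Implicit.
Unset Printing Implicit Defensive.

Import Order.TTheory GRing.Theory Num.Theory.
Import numFieldNormedType.Exports.

Local Open Scope classical_set_scope.
Local Open Scope ring_scope.

(* The library norm [`|x|] on matrices is the entrywise sup norm, so it serves
   as the l^infty norm of a vector; only l^1 and l^2 are defined here. *)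
Definition norm1 (R : realType) (d : nat) (x : 'cV[R]_d) : R :=
  \sum_(j < d) `|x j 0|.

Definition norm2 (R : realType) (d : nat) (x : 'cV[R]_d) : R :=
  Num.sqrt (\sum_(j < d) x j 0 ^+ 2).

Definition supp (R : realType) (d : nat) (u : 'cV[R]_d) : {set 'I_d} :=
  [set j | u j 0 != 0]%SET.

(* Padded by zeros outside S, so that u_S stays a vector of length d. *)
Definition restrict_to (R : realType) (d : nat) (S : {set 'I_d})
    (u : 'cV[R]_d) : 'cV[R]_d :=
  \col_(j < d) (if j \in S then u j 0 else 0).

Definition J_functional (R : realType) (n d : nat) (A : 'M[R]_(n, d))
    (y : 'cV[R]_n) (lambda eta : R) (p : 'cV[R]_d * 'cV[R]_d) : R :=
  let: (u, theta) := p in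
  1 / (2 * n%:R) * norm2 (y - A *m u) ^+ 2
  + lambda / (2 * Num.sqrt 2) * \sum_(j < d) (u j 0 ^+ 2 / theta j 0)
  + lambda / Num.sqrt 2 *
      \sum_(j < d) (theta j 0 - eta * ln (theta j 0)).

Definition J_domain (R : realType) (d : nat) : set ('cV[R]_d * 'cV[R]_d) :=
  [set p : 'cV[R]_d * 'cV[R]_d | forall j : 'I_d, 0 < p.2 j 0].
Arguments J_domain : clear implicits.

Definition is_minimizer (R : realType) (T : Type) (D : set T) (f : T -> R)
    (x : T) : Prop :=
  D x /\ forall z, D z -> f x <= f z.

Definition restricted_strong_convexity (R : realType) (n d : nat)
    (A : 'M[R]_(n, d)) (N : 'cV[R]_d -> R) (kappa tol : R) : Prop :=
  forall Delta : 'cV[R]_d,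
    kappa / 2 * norm2 Delta ^+ 2 - tol * N Delta ^+ 2
      <= norm2 (A *m Delta) ^+ 2 / (2 * n%:R).

Definition E_eta (R : realType) (d : nat) (S : {set 'I_d}) (ustar : 'cV[R]_d)
    (lambda eta kappa tau : R) : R :=
  tau ^+ 2 / kappa *
    (eta ^+ 2 * norm1 (restrict_to S ustar) ^+ 2
     + d%:R ^+ 2 * eta ^+ 2 / 2 * (2 - ln eta) ^+ 2)
  + lambda / kappa *
    (eta * norm1 (restrict_to S ustar)
     + d%:R * eta / Num.sqrt 2 * (2 - ln eta)).

(* Main.v *)
(* Minimizing the penalty over theta turns it into a perturbed l1 norm. Since
   ln t <= t / 2, AM-GM bounds it below by lambda (1 - eta / 2) |u|_1, whereas
   theta_j = |u_j| / sqrt 2 + eta bounds it above by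
   lambda (|u|_1 + d eta (1 - ln eta) / sqrt 2). Comparing J at the minimizer
   with its value at ustar and this theta gives, as for the Lasso,
   |A Delta|^2 / 2n <= lambda (3/2 a - b/4 + B), where a and b are the l1 norms
   of Delta on and off S and B = eta |ustar_S|_1 + d eta (2 - ln eta) / sqrt 2.
   The slope of the lower bound stays above 3/4, so the noise, of size lambda / 2,
   is absorbed off S. Hence b <= 6 a + 4 B, and restricted strong convexity
   together with a <= sqrt s |Delta|_2 yields the estimate. *)

Require Import Defs.
From HB Require Import structures.
From mathcomp Require Import all_boot all_order all_algebra.
From mathcomp Require Import all_classical all_reals all_analysis.
From mathcomp Require Import ring lra.

Set Implicit Arguments.
Unset Strict Implicit.
Unset Printing Implicit Defensive.

Import Order.TTheory GRing.Theory Num.Theory.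
Import numFieldNormedType.Exports.

Local Open Scope ring_scope.

(** * Scalar bounds on the penalty of one coordinate *)

(** Apply [ln x <= x - 1] at [t / 2] and at [2]: the constants [-1] and [1] cancel. *)
Lemma ln_le_half (R : realType) (t : R) : 0 < t -> ln t <= t / 2.
Proof.
move=> t0.
have ln_leB1 (x : R) : 0 < x -> ln x <= x - 1.
  by move=> x0; have := @le_ln1Dx R (x - 1); rewrite subrKC; apply; lra.
have -> : ln t = ln (t / 2) + ln 2.
  by rewrite ln_div ?posrE ?subrK.
have := ln_leB1 2 ltac:(lra).
have := ln_leB1 (t / 2) ltac:(lra).
lra.
Qed.

(** The logarithm costs at most [eta * t / 2], leaving the weight [1 - eta / 2] on [t]. The AM-GM
    bound is scaled by this weight, and the rest of the quotient term is nonnegative. *)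
Lemma penalty_lower (R : realType) (eta t u : R) : 0 < eta -> eta < 1 / 2 ->
  0 < t ->
  (1 - eta / 2) * `|u| <=
    1 / (2 * Num.sqrt 2) * (u ^+ 2 / t) + 1 / Num.sqrt 2 * (t - eta * ln t).
Proof.
move=> eta0 eta1 t0.
have r0 : 0 < Num.sqrt 2 :> R by rewrite sqrtr_gt0.
have rr : Num.sqrt 2 ^+ 2 = 2 :> R by rewrite sqr_sqrtr.
set r := Num.sqrt 2 in r0 rr *.
have lnt := ln_le_half t0.
have mu0 : 0 <= 1 - eta / 2 by lra.
have amgm : r * `|u| <= u ^+ 2 / (2 * t) + t.
  rewrite -subr_ge0 -(real_normK (num_real u)).
  have -> : `|u| ^+ 2 / (2 * t) + t - r * `|u| =
            (`|u| - r * t) ^+ 2 / (2 * t).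
    have -> : (`|u| - r * t) ^+ 2 = `|u| ^+ 2 - 2 * r * t * `|u| + r ^+ 2 * t ^+ 2
      by ring.
    by rewrite rr; field; lra.
  by rewrite divr_ge0 ?sqr_ge0 //; lra.
have main : (1 - eta / 2) * (r * `|u|) <= u ^+ 2 / (2 * t) + (t - eta * ln t).
  have q0 : 0 <= u ^+ 2 / (2 * t) by rewrite divr_ge0 ?sqr_ge0 //; lra.
  nra.
rewrite -(ler_pM2l r0).
have -> : r * (1 / (2 * r) * (u ^+ 2 / t) + 1 / r * (t - eta * ln t)) =
          u ^+ 2 / (2 * t) + (t - eta * ln t) by field; lra.
by rewrite mulrCA.
Qed.

(** The value [|u| / sqrt 2] minimizes [u ^+ 2 / (2 * t) + t]; shifting it by [eta] keeps
    [ln t >= ln eta], even at [u = 0]. *)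
Lemma penalty_upper (R : realType) (eta t u : R) : 0 < eta ->
  t = `|u| / Num.sqrt 2 + eta ->
  1 / (2 * Num.sqrt 2) * (u ^+ 2 / t) + 1 / Num.sqrt 2 * (t - eta * ln t) <=
    `|u| + eta / Num.sqrt 2 * (1 - ln eta).
Proof.
move=> eta0 tE.
have r0 : 0 < Num.sqrt 2 :> R by rewrite sqrtr_gt0.
have rr : Num.sqrt 2 ^+ 2 = 2 :> R by rewrite sqr_sqrtr.
set r := Num.sqrt 2 in r0 rr tE *.
have ur0 : 0 <= `|u| / r by rewrite divr_ge0 // ltW.
have t0 : 0 < t by lra.
have lnt : eta * ln eta <= eta * ln t by rewrite ler_pM2l // ler_ln ?posrE //; lra.
have quot : u ^+ 2 / t <= r * `|u|.
  rewrite ler_pdivrMr // -(real_normK (num_real u)).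
  have -> : r * `|u| * t = `|u| ^+ 2 + r * `|u| * eta.
    by rewrite tE; field; lra.
  by rewrite lerDl !mulr_ge0 ?(ltW r0) ?(ltW eta0).
have ru : r * `|u| = 2 * (`|u| / r) by rewrite -rr; field; lra.
rewrite -(ler_pM2l r0).
have -> : r * (1 / (2 * r) * (u ^+ 2 / t) + 1 / r * (t - eta * ln t)) =
          u ^+ 2 / t / 2 + (t - eta * ln t) by field; lra.
have -> : r * (`|u| + eta / r * (1 - ln eta)) =
          r * `|u| + eta * (1 - ln eta) by field; lra.
lra.
Qed.

(** * Norm inequalities *)

Lemma norm2_sqr (R : realType) (d : nat) (x : 'cV[R]_d) :
  norm2 x ^+ 2 = \sum_j x j 0 ^+ 2.
Proof. by rewrite sqr_sqrtr // sumr_ge0 // => j _; rewrite sqr_ge0. Qed.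

Lemma norm1_ge0 (R : realType) (d : nat) (x : 'cV[R]_d) : 0 <= norm1 x.
Proof. exact: sumr_ge0. Qed.

Lemma norm1_restrict (R : realType) (d : nat) (S : {set 'I_d}) (x : 'cV[R]_d) :
  norm1 (restrict_to S x) = \sum_(j in S) `|x j 0|.
Proof.
rewrite [RHS]big_mkcond; apply: eq_bigr => j _.
by rewrite mxE; case: ifP => // _; rewrite normr0.
Qed.

(** Cauchy-Schwarz, read off from the nonnegative variance of the [|x j 0|] over [S]. *)
Lemma norm1_restrict_sqr (R : realType) (d : nat) (S : {set 'I_d})
    (x : 'cV[R]_d) :
  norm1 (restrict_to S x) ^+ 2 <= #|S|%:R * norm2 x ^+ 2.
Proof.
rewrite norm1_restrict norm2_sqr.
set T := \sum_(j in S) _; set s : R := #|S|%:R.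
(* The variance identity is divided by [s], so the empty set is treated apart. *)
have [S0|S0] := posnP #|S|.
  by rewrite /T /s (cards0_eq S0) big_set0 cards0 expr0n mul0r.
have s0 : 0 < s by rewrite ltr0n.
have T2 : T ^+ 2 <= s * \sum_(j in S) x j 0 ^+ 2.
  have : 0 <= \sum_(j in S) (s * `|x j 0| - T) ^+ 2.
    by apply: sumr_ge0 => j _; rewrite sqr_ge0.
  have -> : \sum_(j in S) (s * `|x j 0| - T) ^+ 2 =
            s * (s * \sum_(j in S) x j 0 ^+ 2 - T ^+ 2).
    transitivity (\sum_(j in S) (s ^+ 2 * x j 0 ^+ 2
                    - 2 * s * T * `|x j 0| + T ^+ 2)).
      apply: eq_bigr => j _; rewrite -(real_normK (num_real (x j 0))); ring.
    rewrite !big_split /= -mulr_sumr sumrN -mulr_sumr sumr_const -/T.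
    by rewrite -[_ *+ #|_|]mulr_natr -/s; ring.
  by rewrite pmulr_rge0 // subr_ge0.
apply: (le_trans T2); rewrite ler_pM2l // [leLHS]big_mkcond.
by apply: ler_sum => j _; case: ifP => // _; rewrite sqr_ge0.
Qed.

Lemma dot_le_norm1 (R : realType) (d : nat) (x z : 'cV[R]_d) :
  (x^T *m z) 0 0 <= `|x| * norm1 z.
Proof.
rewrite mxE mulr_sumr; apply: ler_sum => j _; rewrite mxE.
apply: le_trans (ler_norm _) _; rewrite normrM ler_wpM2r //.
rewrite [leRHS]/Num.Def.normr /= mx_normrE.
exact: (@le_bigmax _ _ _ 0 (fun i => `|x i.1 i.2|) (j, 0)).
Qed.

Lemma norm2_subr_sqr (R : realType) (n : nat) (x z : 'cV[R]_n) :
  norm2 (x - z) ^+ 2 = norm2 x ^+ 2 - 2 * (x^T *m z) 0 0 + norm2 z ^+ 2.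
Proof.
rewrite !norm2_sqr mxE mulr_sumr -sumrN -!big_split /=.
by apply: eq_bigr => j _; rewrite !mxE; ring.
Qed.

(** * The basic inequality *)

Definition penalty (R : realType) (d : nat) (lambda eta : R)
    (u theta : 'cV[R]_d) : R :=
  lambda / (2 * Num.sqrt 2) * \sum_(j < d) (u j 0 ^+ 2 / theta j 0)
  + lambda / Num.sqrt 2 *
      \sum_(j < d) (theta j 0 - eta * ln (theta j 0)).

Lemma penaltyE (R : realType) (d : nat) (lambda eta : R)
    (u theta : 'cV[R]_d) :
  penalty lambda eta u theta = lambda * \sum_j
    (1 / (2 * Num.sqrt 2) * (u j 0 ^+ 2 / theta j 0)
     + 1 / Num.sqrt 2 * (theta j 0 - eta * ln (theta j 0))).
Proof. by rewrite [in RHS]big_split /= -!mulr_sumr /penalty; ring. Qed.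

Lemma J_functionalE (R : realType) (n d : nat) (A : 'M[R]_(n, d))
    (y : 'cV[R]_n) (lambda eta : R) (u theta : 'cV[R]_d) :
  J_functional A y lambda eta (u, theta) =
  1 / (2 * n%:R) * norm2 (y - A *m u) ^+ 2 + penalty lambda eta u theta.
Proof. by rewrite /J_functional /penalty addrA. Qed.

Lemma basic_inequality (R : realType) (n d : nat) (A : 'M[R]_(n, d))
    (ustar : 'cV[R]_d) (eps : 'cV[R]_n) (S : {set 'I_d}) (lambda eta : R)
    (uhat thetahat : 'cV[R]_d) :
  (0 < n)%N -> supp ustar \subset S -> 0 < lambda -> 0 < eta -> eta < 1 / 2 ->
  is_minimizer (J_domain R d)
    (J_functional A (A *m ustar + eps) lambda eta) (uhat, thetahat) ->
  2 * `|A^T *m eps| / n%:R <= lambda ->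
  norm2 (A *m (uhat - ustar)) ^+ 2 / (2 * n%:R) <=
    lambda * (3 / 2 * norm1 (restrict_to S (uhat - ustar))
      - 1 / 4 * norm1 (restrict_to (~: S) (uhat - ustar))
      + (eta * norm1 (restrict_to S ustar)
         + d%:R * eta / Num.sqrt 2 * (2 - ln eta))).
Proof.
move=> n0 suppS lambda0 eta0 eta1 [dom opt] noise; set Delta := uhat - ustar.
have N0 : 0 < n%:R :> R by rewrite ltr0n.
have r0 : 0 < Num.sqrt 2 :> R by rewrite sqrtr_gt0.
(* The competitor from [penalty_upper]; the shift by [eta] makes it admissible where [ustar]
   vanishes. *)
pose theta := \col_j (`|ustar j 0| / Num.sqrt 2 + eta) : 'cV[R]_d.
have domstar : J_domain R d (ustar, theta).
  by move=> j; rewrite mxE ltr_wpDl // divr_ge0 // ltW.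
have := opt _ domstar; rewrite !J_functionalE.
have -> : A *m ustar + eps - A *m uhat = eps - A *m Delta.
  by rewrite mulmxBr opprB [RHS]addrA [eps + _]addrC.
have -> : A *m ustar + eps - A *m ustar = eps by rewrite addrC addKr.
rewrite norm2_subr_sqr.
have -> : (eps^T *m (A *m Delta)) 0 0 = ((A^T *m eps)^T *m Delta) 0 0.
  by rewrite trmx_mul trmxK mulmxA.
have dot := dot_le_norm1 (A^T *m eps) Delta.
set c := (_ *m Delta) 0 0 in dot *; set w := norm2 (A *m Delta) ^+ 2.
set e := norm2 eps ^+ 2 => optJ.
have normS (x : 'cV[R]_d) :
    norm1 x = norm1 (restrict_to S x) + norm1 (restrict_to (~: S) x).
  rewrite !norm1_restrict [LHS](bigID (mem S)) /=; congr (_ + _).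
  by apply: eq_bigl => j; rewrite inE.
have off j : j \notin S -> ustar j 0 = 0.
  move=> jS; apply/eqP; apply: contraNT jS => uj.
  by apply: (fintype.subsetP suppS); rewrite inE.
have starS : norm1 (restrict_to (~: S) ustar) = 0.
  by rewrite norm1_restrict big1 // => j; rewrite inE => /off ->; rewrite normr0.
have hatS : norm1 (restrict_to (~: S) uhat) = norm1 (restrict_to (~: S) Delta).
  rewrite !norm1_restrict; apply: eq_bigr => j; rewrite inE => /off uj.
  by rewrite !mxE uj subr0.
have triS : norm1 (restrict_to S ustar) <=
    norm1 (restrict_to S uhat) + norm1 (restrict_to S Delta).
  rewrite !norm1_restrict -big_split /=; apply: ler_sum => j _.
  rewrite !mxE distrC -{1}[ustar j 0](subrK (uhat j 0)) addrC.
  exact: ler_normD.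
have low : lambda * ((1 - eta / 2) * norm1 uhat) <=
    penalty lambda eta uhat thetahat.
  rewrite penaltyE ler_pM2l // mulr_sumr; apply: ler_sum => j _.
  exact: (penalty_lower _ eta0 eta1 (dom j)).
have up : penalty lambda eta ustar theta <=
    lambda * (norm1 ustar + d%:R * eta / Num.sqrt 2 * (1 - ln eta)).
  rewrite penaltyE ler_pM2l //.
  apply: (@le_trans _ _ (\sum_(j < d)
     (`|ustar j 0| + eta / Num.sqrt 2 * (1 - ln eta)))).
    by apply: ler_sum => j _; apply: penalty_upper; rewrite ?mxE.
  rewrite big_split /= sumr_const card_ord -[_ *+ d]mulr_natl !mulrA.
  by rewrite lexx.
have D0 := norm1_ge0 Delta.
have cn : c / n%:R <= lambda / 2 * norm1 Delta.
  rewrite ler_pdivrMr //; apply: (le_trans dot).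
  rewrite mulrAC ler_wpM2r //.
  by move: noise; rewrite ler_pdivrMr //; lra.
(* Expanding the residual at [uhat] makes the pure noise energy [e] cancel from the two values of
   J. *)
have quad : w / (2 * n%:R) <= c / n%:R + penalty lambda eta ustar theta
    - penalty lambda eta uhat thetahat.
  have -> : w / (2 * n%:R) = 1 / (2 * n%:R) * (e - 2 * c + w)
     - 1 / (2 * n%:R) * e + c / n%:R by field; lra.
  lra.
have dr0 : 0 <= d%:R * eta / Num.sqrt 2 :> R.
  by rewrite divr_ge0 ?mulr_ge0 // ltW.
rewrite (normS ustar) starS addr0 in up.
rewrite (normS uhat) hatS in low.
rewrite (normS Delta) in cn.
have a0 := norm1_ge0 (restrict_to S Delta).
have b0 := norm1_ge0 (restrict_to (~: S) Delta).
have us0 := norm1_ge0 (restrict_to S ustar).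
move: a0 b0 us0 triS low up cn {normS D0 starS hatS}.
set a := norm1 (restrict_to S Delta).
set b := norm1 (restrict_to (~: S) Delta).
set us := norm1 (restrict_to S ustar).
set uh := norm1 (restrict_to S uhat).
set k := _ / Num.sqrt 2 in dr0 *.
move=> a0 b0 us0 triS low up cn.
apply: (@le_trans _ _ (lambda * (1 / 2 * (a + b) + (us + k * (1 - ln eta))
   - (1 - eta / 2) * (uh + b)))); first by lra.
rewrite ler_pM2l //.
(* Here [p1] trades [uh] for [us - a]. Then [p2] raises the coefficient [3 / 2 - eta / 2] of [a] to
   [3 / 2], [p3] raises [- (1 - eta) / 2] of [b] to [- 1 / 4], and [p4] raises [eta / 2] of [us] to
   [eta]. *)
have p1 : (1 - eta / 2) * us <= (1 - eta / 2) * (uh + a).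
  by rewrite ler_wpM2l //; lra.
have p2 : 0 <= eta * a by rewrite mulr_ge0 // ltW.
have p3 : 0 <= (1 / 2 - eta) * b by rewrite mulr_ge0 //; lra.
have p4 : 0 <= eta * us by rewrite mulr_ge0 // ltW.
lra.
Qed.

(* Here [a], [b] are the l1 norms of the error on S and off S, [N] its l2 norm,
   [q] the empirical quadratic form, [p + g] the bias and [t] the square root of
   |S|. *)
Lemma cone_error_bound (R : realFieldType) (a b p g q N t sk kappa lambda tau : R) :
  0 <= a -> 0 <= b -> 0 <= p -> 0 <= g -> 0 <= q -> 0 <= N -> 0 <= t ->
  0 < kappa -> 0 < lambda -> 0 <= tau -> sk ^+ 2 = kappa ->
  a <= t * N -> tau * t <= sk / 32 ->
  q <= lambda * (3 / 2 * a - 1 / 4 * b + (p + g)) ->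
  kappa / 2 * N ^+ 2 - tau ^+ 2 * (a + b) ^+ 2 <= q ->
  N ^+ 2 <= 500 * (t ^+ 2 * (lambda ^+ 2 / kappa ^+ 2) +
    (tau ^+ 2 / kappa * (p ^+ 2 + g ^+ 2) + lambda / kappa * (p + g))).
Proof.
move=> a0 b0 p0 g0 q0 N0 t0 kappa0 lambda0 tau0 skE aN tauS qle rsc.
(* Since [q] is nonnegative, the bracket bounding it is too, which controls [b] by [a] and the
   bias. *)
have cone : a + b <= 7 * a + 4 * (p + g).
  have : 0 <= 3 / 2 * a - 1 / 4 * b + (p + g).
    by rewrite -(pmulr_rge0 _ lambda0); apply: le_trans qle.
  lra.
have taua : tau * a <= sk / 32 * N.
  apply: (@le_trans _ _ (tau * t * N)); last by rewrite ler_wpM2r.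
  by rewrite -mulrA ler_wpM2l.
have tab : tau * (a + b) <= 7 * (sk / 32 * N) + 4 * (tau * (p + g)).
  have : tau * (a + b) <= tau * (7 * a + 4 * (p + g)) by rewrite ler_wpM2l.
  lra.
(* From [(x + y)^2 <= 2 x^2 + 2 y^2], used twice: [98 = 2 * 7^2] over [32^2], and
   [64 = 2 * 4^2 * 2]. *)
have tol : tau ^+ 2 * (a + b) ^+ 2 <=
    98 / 1024 * (kappa * N ^+ 2) + 64 * (tau ^+ 2 * (p ^+ 2 + g ^+ 2)).
  have tab0 : 0 <= tau * (a + b) by rewrite mulr_ge0 // addr_ge0.
  have : (tau * (a + b)) ^+ 2 <= (7 * (sk / 32 * N) + 4 * (tau * (p + g))) ^+ 2.
    by rewrite lerXn2r // nnegrE //; apply: le_trans tab.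
  have sq1 : 0 <= (7 * (sk / 32 * N) - 4 * (tau * (p + g))) ^+ 2 by exact: sqr_ge0.
  have sq2 : 0 <= (tau * (p - g)) ^+ 2 by exact: sqr_ge0.
  rewrite -skE; nra.
(* Young's inequality, weighted to spend half of the curvature term [kappa / 2 * N ^+ 2]. *)
have noise : lambda * (3 / 2 * a) <=
    kappa * N ^+ 2 / 4 + 9 / 4 * (t ^+ 2 * (lambda ^+ 2 / kappa)).
  apply: (@le_trans _ _ (lambda * (3 / 2 * (t * N)))).
    by rewrite ler_pM2l // ler_pM2l //; lra.
  rewrite -subr_ge0.
  have -> : kappa * N ^+ 2 / 4 + 9 / 4 * (t ^+ 2 * (lambda ^+ 2 / kappa))
    - lambda * (3 / 2 * (t * N)) = (kappa * N / 2 - 3 / 2 * (t * lambda)) ^+ 2 / kappa.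
    by field; lra.
  by rewrite divr_ge0 ?sqr_ge0 // ltW.
have lb0 : 0 <= lambda * b by rewrite mulr_ge0 // ltW.
have z1 : 0 <= t ^+ 2 * (lambda ^+ 2 / kappa).
  by rewrite mulr_ge0 ?sqr_ge0 // divr_ge0 ?sqr_ge0 // ltW.
have z2 : 0 <= tau ^+ 2 * (p ^+ 2 + g ^+ 2).
  by rewrite mulr_ge0 ?sqr_ge0 // addr_ge0 ?sqr_ge0.
have z3 : 0 <= lambda * (p + g) by rewrite mulr_ge0 ?addr_ge0 // ltW.
(* The curvature left over is [1 / 2 - 98 / 1024 - 1 / 4 = 158 / 1024]; the largest constant on the
   right is [64], and [64 * 1024 / 158 < 500]. *)
rewrite -(ler_pM2l kappa0).
have -> : kappa * (500 * (t ^+ 2 * (lambda ^+ 2 / kappa ^+ 2) +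
    (tau ^+ 2 / kappa * (p ^+ 2 + g ^+ 2) + lambda / kappa * (p + g)))) =
  500 * (t ^+ 2 * (lambda ^+ 2 / kappa) +
    (tau ^+ 2 * (p ^+ 2 + g ^+ 2) + lambda * (p + g))) by field; lra.
lra.
Qed.

Theorem theorem4p1 (R : realType) :
  exists C : R, 0 < C /\
  forall (n d s : nat) (A : 'M[R]_(n, d)) (ustar : 'cV[R]_d)
    (eps y : 'cV[R]_n) (S : {set 'I_d}) (lambda eta kappa tau : R)
    (uhat thetahat : 'cV[R]_d),
  (0 < n)%N ->
  y = A *m ustar + eps ->
  supp ustar \subset S ->
  #|S| = s ->
  0 < lambda ->
  0 < eta -> eta < 1 / 2 ->
  is_minimizer (J_domain R d) (J_functional A y lambda eta) (uhat, thetahat) ->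
  2 * `|A^T *m eps| / n%:R <= lambda ->
  0 < kappa ->
  0 <= tau ->
  restricted_strong_convexity A (@norm1 R d) kappa (tau ^+ 2) ->
  tau * Num.sqrt s%:R <= Num.sqrt kappa / 32 ->
  norm2 (uhat - ustar) ^+ 2
    <= C * (s%:R * (lambda ^+ 2 / kappa ^+ 2)
            + E_eta S ustar lambda eta kappa tau).
Proof.
exists 500; split; first by rewrite ltr0n.
move=> n d s A ustar eps y S lambda eta kappa tau uhat thetahat n0 yE suppS Ss.
move=> lambda0 eta0 eta1 opt noise kappa0 tau0 rsc tauS; subst y s.
have basic := basic_inequality n0 suppS lambda0 eta0 eta1 opt noise.
(* The sign makes [2 - ln eta] positive, hence the logarithmic bias nonnegative. *)
have lneta : ln eta < 0 by apply: ln_lt0; lra.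
have sE : #|S|%:R = Num.sqrt #|S|%:R ^+ 2 :> R by rewrite sqr_sqrtr.
rewrite /E_eta sE.
(* The factor [1 / 2] is the square of [1 / sqrt 2], so the tolerance part of [E_eta] takes the form
   [p ^+ 2 + g ^+ 2]. *)
have -> : d%:R ^+ 2 * eta ^+ 2 / 2 * (2 - ln eta) ^+ 2 =
    (d%:R * eta / Num.sqrt 2 * (2 - ln eta)) ^+ 2.
  by rewrite !exprMn exprVn (@sqr_sqrtr R 2).
rewrite -(exprMn _ eta).
apply: (@cone_error_bound R (norm1 (restrict_to S (uhat - ustar)))
  (norm1 (restrict_to (~: S) (uhat - ustar))) _ _ _ _ _ (Num.sqrt kappa)
  _ _ _ _ _ _ _ _ _ _ _ _ _ _ _ tauS basic); rewrite ?norm1_ge0 ?sqrtr_ge0 //.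
- by rewrite mulr_ge0 ?norm1_ge0 // ltW.
- rewrite mulr_ge0 //; last by lra.
  by rewrite divr_ge0 ?mulr_ge0 ?sqrtr_ge0 // ltW.
- by rewrite divr_ge0 ?sqr_ge0 // mulr_ge0.
- by rewrite sqr_sqrtr // ltW.
- rewrite -(@ler_pXn2r _ 2) ?nnegrE ?mulr_ge0 ?norm1_ge0 ?sqrtr_ge0 //.
  by rewrite exprMn sqr_sqrtr // norm1_restrict_sqr.
- have := rsc (uhat - ustar); congr (_ - _ * _ ^+ 2 <= _).
  rewrite !norm1_restrict /norm1 (bigID (mem S)) /=; congr (_ + _).
  by apply: eq_bigl => j; rewrite inE.
Qed.
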